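(* For every integer $l \ge 1$, the resolving domination number of the fractal cubic network $FCN(l)$ satisfies $\gamma_r(FCN(l)) = 4\,\gamma_2(FCN(l-1))$, where $\gamma_2$ denotes the 2-domination number.
   Context: Fractal cubic network: for an integer $l\ge 0$, $FCN(l)$ is the finite simple graph whose vertices are all binary strings of length $2l+2$, defined recursively as follows. $FCN(0)$ is the 4-cycle with vertices $00, 01, 11, 10$ in this cyclic order. For $l\ge 1$, $FCN(l)$ is obtained from the disjoint union of the four copies $ab\,\Vert\,FCN(l-1)$, $a,b\in\{0,1\}$ (each vertex string of $FCN(l-1)$ is prefixed by $ab$, adjacency inside a copy being that of $FCN(l-1)$), by adding the four edges $\{00w,10w\}$, $\{10w,11w\}$, $\{11w,01w\}$, $\{01w,00w\}$, where $w=10(01)^{l-1}$ is the string $10$ followed by $l-1$ repetitions of $01$. A set $R\subseteq V(\Gamma)$ of a connected graph $\Gamma$ is a resolving set if for every two distinct vertices $g,h$ there is $r\in R$ with $d(g,r)\ne d(h,r)$ (graph distance). A dominating set is a set $D\subseteq V(\Gamma)$ such that every vertex is in $D$ or adjacent to a vertex of $D$. A resolving dominating set is a set that is both resolving and dominating; $\gamma_r(\Gamma)$ is the minimum size of such a set. A 2-dominating set is a set $D$ such that every $v\in V(\Gamma)\setminus D$ has at least two neighbors in $D$; $\gamma_2(\Gamma)$ is the minimum size of a 2-dominating set. *)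

(* Defs.v *)
From mathcomp Require Import all_boot.

Set Implicit Arguments.
Unset Strict Implicit.
Unset Printing Implicit Defensive.

Structure sgraph := SGraph {
  vertex :> finType;
  adj : rel vertex;
  adj_sym : symmetric adj;
  adj_irrefl : irreflexive adj }.

Section GraphInvariants.
Variable G : sgraph.
Implicit Types (x y : G) (D : {set G}).

Definition connected_graph := forall x y, connect (@adj G) x y.

Definition walk_of_length x y (k : nat) : bool :=
  [exists p : k.-tuple G, path (@adj G) x p && (last x p == y)].

(* Least length of a walk from x to y. Lengths below #|G| suffice; the value
   is #|G| when y is not reachable from x, which never happens in FCN l by
   FCN_connected. *)
Definition gdist x y : nat := find (walk_of_length x y) (iota 0 #|G|).

Definition resolving D : bool :=
  [forall x, forall y, (x != y) ==>
     [exists r in D, gdist x r != gdist y r]].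

Definition dominating D : bool :=
  [forall x, (x \in D) || [exists y in D, adj x y]].

Definition two_dominating D : bool :=
  [forall x, (x \notin D) ==> (2 <= #|[set y in D | adj x y]|)].

Definition resolving_dominating D : bool := resolving D && dominating D.

(* The minima range over nonempty families: see resolving_dominatingT and
   two_dominatingT. *)
Definition resolving_domination_number : nat :=
  #|[arg min_(D < [set: G] | resolving_dominating D) #|D|]|.

Definition two_domination_number : nat :=
  #|[arg min_(D < [set: G] | two_dominating D) #|D|]|.

Lemma walk_of_lengthP x y k :
  reflect (exists p, [/\ size p = k, path (@adj G) x p & last x p = y])
          (walk_of_length x y k).
Proof.
apply: (iffP existsP) => [[p /andP[pp /eqP lp]]|[p [sp pp lp]]].
  by exists p; rewrite size_tuple.
have sp' : size p == k by rewrite sp.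
by exists (Tuple sp'); rewrite /= pp lp /=.
Qed.

Lemma gdist_walk x y : connect (@adj G) x y -> walk_of_length x y (gdist x y).
Proof.
case/connectP=> p0 + ->; case/shortenP=> p pp up _.
have hk : walk_of_length x (last x p) (size p).
  by apply/walk_of_lengthP; exists p.
have sz : size p < #|G| by have:= max_card (mem (x :: p)); rewrite (card_uniqP up).
have hs : has (walk_of_length x (last x p)) (iota 0 #|G|).
  by apply/hasP; exists (size p) => //; rewrite mem_iota add0n.
have := nth_find 0 hs; rewrite nth_iota ?add0n //.
by move: hs; rewrite has_find size_iota.
Qed.

Lemma gdist_min x y k : walk_of_length x y k -> gdist x y <= k.
Proof.
move=> hk; case: (ltnP k #|G|) => [lk|]; last first.
  by apply: leq_trans; rewrite -[X in _ <= X](size_iota 0) find_size.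
rewrite leqNgt; apply/negP=> /(before_find 0).
by rewrite nth_iota // add0n hk.
Qed.

Lemma gdist_eq0 x y : (gdist x y == 0) = (x == y).
Proof.
apply/eqP/eqP=> [d0|->]; last first.
  by apply/eqP; rewrite -leqn0 gdist_min //; apply/walk_of_lengthP; exists [::].
have : has (walk_of_length x y) (iota 0 #|G|).
  rewrite has_find size_iota -/(gdist x y) d0; apply/card_gt0P; by exists x.
move/(nth_find 0); rewrite -/(gdist x y) d0 nth_iota; last first.
  by apply/card_gt0P; exists x.
by case/walk_of_lengthP=> p [/size0nil -> _].
Qed.

Lemma resolving_dominatingT : resolving_dominating [set: G].
Proof.
apply/andP; split; last by apply/forallP=> x; rewrite inE.
apply/forallP=> x; apply/forallP=> y; apply/implyP=> nxy.
apply/existsP; exists x; rewrite inE /=.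
have /eqP-> : gdist x x == 0 by rewrite gdist_eq0.
by rewrite eq_sym gdist_eq0 eq_sym.
Qed.

Lemma two_dominatingT : two_dominating [set: G].
Proof. by apply/forallP=> x; rewrite inE. Qed.

End GraphInvariants.

Definition bits00 := [:: false; false].
Definition bits01 := [:: false; true].
Definition bits10 := [:: true; false].
Definition bits11 := [:: true; true].

Definition cycle4_edges : seq (seq bool * seq bool) :=
  [:: (bits00, bits01); (bits01, bits11); (bits11, bits10); (bits10, bits00)].

Definition cycle4_adj : rel (seq bool) :=
  fun u v => ((u, v) \in cycle4_edges) || ((v, u) \in cycle4_edges).

Definition fcn_word (l : nat) : seq bool :=
  bits10 ++ flatten (nseq l.-1 bits01).

(* The four edges joining the copies, {00w,10w}, {10w,11w}, {11w,01w} and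
   {01w,00w}, arrange the prefixes in the same 4-cycle as FCN(0). *)
Fixpoint fcn_adj (l : nat) : rel (seq bool) := fun u v =>
  if l is l'.+1 then
    ((take 2 u == take 2 v) && fcn_adj l' (drop 2 u) (drop 2 v))
    || [&& drop 2 u == fcn_word l, drop 2 v == fcn_word l
         & cycle4_adj (take 2 u) (take 2 v)]
  else cycle4_adj u v.

Lemma cycle4_adj_sym : symmetric cycle4_adj.
Proof. by move=> u v; rewrite /cycle4_adj orbC. Qed.

Lemma cycle4_adj_irrefl : irreflexive cycle4_adj.
Proof.
by move=> u; rewrite /cycle4_adj orbb !inE !xpair_eqE;
   case: u => [|[] [|[] [|? ?]]].
Qed.

Lemma fcn_adj_sym l : symmetric (fcn_adj l).
Proof.
elim: l => [|l IH] u v; first exact: cycle4_adj_sym.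
by rewrite /= eq_sym IH cycle4_adj_sym andbCA.
Qed.

Lemma fcn_adj_irrefl l : irreflexive (fcn_adj l).
Proof.
elim: l => [|l IH] u; first exact: cycle4_adj_irrefl.
by rewrite /= IH cycle4_adj_irrefl !andbF.
Qed.

Definition FCN (l : nat) : sgraph :=
  @SGraph ((l.*2.+2).-tuple bool) (fun u v => fcn_adj l u v)
    (fun u v => fcn_adj_sym l u v) (fun u => fcn_adj_irrefl l u).

Lemma size_fcn_word l : size (fcn_word l.+1) = l.*2.+2.
Proof. by elim: l => //= l; rewrite /fcn_word /= => ->. Qed.

Lemma FCN_connected l : connected_graph (FCN l).
Proof.
elim: l => [|l IH].
  have step (u v : FCN 0) : cycle4_adj u v -> connect (@adj (FCN 0)) u v.
    by move=> h; apply: connect1.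
  have h0 (u : FCN 0) : connect (@adj (FCN 0)) u [tuple false; false].
    case/tupleP: u => a u; case/tupleP: u => b u; rewrite (tuple0 u).
    case: a b => [] [].
    - by apply: (@connect_trans _ _ [tuple false; true]); apply: step.
    - exact: step.
    - exact: step.
    - exact: connect0.
  have cs : connect_sym (@adj (FCN 0)) by apply: sym_connect_sym; apply: adj_sym.
  by move=> u v; apply: connect_trans (h0 u) _; rewrite cs.
pose c (a b : bool) (x : FCN l) : FCN l.+1 := [tuple of a :: b :: x].
have inC a b x y : connect (@adj (FCN l.+1)) (c a b x) (c a b y).
  have /connectP[p pp ->] := IH x y.
  elim: p x pp => [|z p IHp] x /=; first by rewrite connect0.
  case/andP=> xz pz; apply: connect_trans (IHp _ pz); apply: connect1.
  by rewrite /adj /= !drop0 !take0 eqxx xz.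
have sw : size (fcn_word l.+1) == l.*2.+2 by rewrite size_fcn_word.
pose w : FCN l := Tuple sw.
have step a b a' b' : cycle4_adj [:: a; b] [:: a'; b'] ->
    connect (@adj (FCN l.+1)) (c a b w) (c a' b' w).
  move=> h; apply: connect1; apply/orP; right.
  by apply/and3P; split; [exact: eqxx | exact: eqxx | exact: h].
have h0 (u : FCN l.+1) : connect (@adj (FCN l.+1)) u (c false false w).
  case/tupleP: u => a u; case/tupleP: u => b u.
  have -> : [tuple of a :: [tuple of b :: u]] = c a b u by exact: val_inj.
  apply: connect_trans (inC a b u w) _.
  case: a b => [] [].
  - by apply: (@connect_trans _ _ (c false true w)); apply: step.
  - exact: step.
  - exact: step.
  - exact: connect0.
have cs : connect_sym (@adj (FCN l.+1)) by apply: sym_connect_sym; apply: adj_sym.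
by move=> u v; apply: connect_trans (h0 u) _; rewrite cs.
Qed.

(* Main.v *)
(* Split the vertices of FCN l into the 4-cycles of the lowest level, the
   blocks s00, s01, s11, s10. The joining edges only use vertices ending in 01
   or 10, so s00 and s11 are false twins with neighbours s01 and s10. False
   twins force a resolving dominating set, and likewise a 2-dominating set, to
   have two elements in each of the 4 ^ l blocks. Conversely the set of all
   s00 and s11 is 2-dominating, and for l >= 1 it is resolving and dominating.
   Hence both invariants equal 2 * 4 ^ l. *)
Require Import Defs.
From mathcomp Require Import all_boot.

Set Implicit Arguments.
Unset Strict Implicit.
Unset Printing Implicit Defensive.

(** * False twins, distances and domination in a general graph *)

Section FalseTwins.
Variable G : sgraph.
Implicit Types (x y z : G) (D : {set G}).

(** With the next lemma, this turns distances up to 2 into adjacency; the resolving argument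
    compares no larger ones. *)
Lemma gdist_le1P x y : connected_graph G ->
  reflect (x = y \/ adj x y) (gdist x y <= 1).
Proof.
move=> Gc; apply: (iffP idP) => [|[->|xy]].
- have /walk_of_lengthP[p [<-]] := gdist_walk (Gc x y).
  by case: p => [|z []] //= => [|/andP[xz _] <-]; [left | right].
- by apply: leq_trans (gdist_min (k := 0) _) _ => //; apply/walk_of_lengthP; exists [::].
- by apply/gdist_min/walk_of_lengthP; exists [:: y]; rewrite /= xy.
Qed.

Lemma gdist_le2P x y : connected_graph G ->
  reflect (gdist x y <= 1 \/ exists2 z, adj x z & adj z y) (gdist x y <= 2).
Proof.
move=> Gc; apply: (iffP idP) => [|[/leqW //|[z xz zy]]].
  rewrite leq_eqVlt => /orP[/eqP d2|]; last by left.
  have /walk_of_lengthP[p []] := gdist_walk (Gc x y).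
  rewrite d2; case: p => [|z [|t []]] //= _ /and3P[xz zt _] <-.
  by right; exists z.
by apply/gdist_min/walk_of_lengthP; exists [:: z; y]; rewrite /= xz zy.
Qed.

(** Replacing the start [x] of a nonempty walk by [y] keeps it a walk of the same length, and empty
    walks to [z] are excluded. *)
Lemma gdist_twin x y z :
  adj x =1 adj y -> x != z -> y != z -> gdist x z = gdist y z.
Proof.
move=> xy nxz nyz; apply: eq_find => k.
apply/walk_of_lengthP/walk_of_lengthP => -[] [|t p] [<- /= pth lst].
- by rewrite lst eqxx in nxz.
- by exists (t :: p); rewrite /= -xy.
- by rewrite lst eqxx in nyz.
- by exists (t :: p); rewrite /= xy.
Qed.

Variables (x y : G).
Hypotheses (nxy : x != y) (xy : adj x =1 adj y).

Definition twin_neighbourhood : {set G} :=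
  [set z | [|| z == x, z == y | adj x z]].

(** If a twin is outside [D], its two neighbours in [D] are neighbours of both twins; otherwise [D]
    contains both twins. *)
Lemma twin_two_dominating D :
  two_dominating D -> 2 <= #|D :&: twin_neighbourhood|.
Proof.
move/forallP=> dom.
have sub : [set z in D | adj x z] \subset D :&: twin_neighbourhood.
  by apply/subsetP=> z; rewrite !inE => /andP[-> ->]; rewrite !orbT.
case: (boolP (x \in D)) => xD; last first.
  by apply: leq_trans (subset_leq_card sub); have := dom x; rewrite xD.
case: (boolP (y \in D)) => yD; last first.
  apply: leq_trans (subset_leq_card sub); have := dom y; rewrite yD /=.
  by under eq_finset => z do rewrite -xy.
apply/card_gt1P; exists x, y.
by rewrite !inE xD yD !eqxx orbT.
Qed.

(** Only a twin can separate the twins, so one lies in [D]. If the other does not, domination gives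
    it a neighbour in [D], which is the second element. *)
Lemma twin_resolving_dominating D :
  resolving_dominating D -> 2 <= #|D :&: twin_neighbourhood|.
Proof.
case/andP=> /forallP/(_ x)/forallP/(_ y); rewrite nxy /=.
move=> /exists_inP[r rD dr] /forallP dom.
have xyF : adj x y = false by rewrite xy adj_irrefl.
have {r rD dr} : (x \in D) || (y \in D).
  apply: contraR dr; rewrite negb_or => /andP[xD yD].
  by apply/eqP/gdist_twin => //; [apply: contraNneq xD | apply: contraNneq yD]
    => ->.
case: (boolP (x \in D)) => [xD _|xD /= yD]; apply/card_gt1P.
  case: (boolP (y \in D)) => yD.
    by exists x, y; rewrite !inE xD yD !eqxx orbT.
  have := dom y; rewrite (negPf yD) => /exists_inP[z zD yz].
  rewrite -xy in yz; exists x, z; rewrite !inE xD zD eqxx yz !orbT.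
  by split=> //; apply: contraTneq yz => <-; rewrite adj_irrefl.
have := dom x; rewrite (negPf xD) => /exists_inP[z zD xz].
exists y, z; rewrite !inE yD zD eqxx xz !orbT.
by split=> //; apply: contraTneq xz => <-; rewrite xyF.
Qed.

End FalseTwins.

Lemma card_arg_min (T : finType) (P : pred {set T}) (A0 A : {set T}) :
    P A0 -> P A -> (forall B, P B -> #|A| <= #|B|) ->
  #|[arg min_(B < A0 | P B) #|B|]| = #|A|.
Proof.
by move=> PA0 PA minA; case: arg_minnP => // B PB minB;
   apply/eqP; rewrite eqn_leq minA ?minB.
Qed.

(** * Adjacency of bit strings split into prefix and suffix *)

Lemma fcn_adj_cat k m s u v :
  size s = k.*2 -> fcn_adj (k + m) (s ++ u) (s ++ v) = fcn_adj m u v.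
Proof.
elim: k s => [|k IH] [|a [|b s]] //= [/IH <-].
by rewrite !take0 !drop0 eqxx cycle4_adj_irrefl !andbF orbF.
Qed.

Lemma fcn_adj_block l s p q :
  size s = l.*2 -> fcn_adj l (s ++ p) (s ++ q) = cycle4_adj p q.
Proof. by move=> sz; rewrite -{1}[l]addn0 fcn_adj_cat. Qed.

(** The joining word ends in 10 at the first level and in 01 above it, so joining edges miss every
    vertex whose last two bits agree. *)
Lemma last_pair_fcn_word l (s : seq bool) a b :
  s ++ [:: a; b] = fcn_word l.+1 -> a = ~~ b.
Proof.
have flattenS n : flatten (nseq n.+1 bits01) = flatten (nseq n bits01) ++ bits01.
  by rewrite -addn1 nseqD flatten_cat.
(* Reversal brings the last two bits to the front. *)
case: l => [|l] /(congr1 rev); rewrite rev_cat => E; first by case: E => -> ->.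
by move: E; rewrite /fcn_word flattenS !rev_cat => -[-> ->].
Qed.

Lemma fcn_adj_same_block l s t a q : size s = l.*2 -> size t = l.*2 ->
  fcn_adj l (s ++ [:: a; a]) (t ++ q) -> s = t.
Proof.
elim: l s t => [|l IH] [|c [|d s]] [|c' [|d' t]] //= [sz] [sz'].
rewrite !take0 !drop0 => /orP[/andP[/eqP[-> ->] /IH->] //|/andP[/eqP]].
by move/last_pair_fcn_word; case: (a).
Qed.

(** * Blocks, their twins and the diagonal set *)

Section Blocks.
Variable l : nat.
Implicit Types (s t : (l.*2).-tuple bool) (u v : FCN l).

Fact size_block_vertex s a b : size (s ++ [:: a; b]) == l.*2.+2.
Proof. by rewrite size_cat size_tuple addn2. Qed.

Definition block_vertex s a b : FCN l := Tuple (size_block_vertex s a b).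

Fact size_block_of u : size (take l.*2 u) == l.*2.
Proof. by rewrite size_takel // size_tuple -addn2 leq_addr. Qed.

Definition block_of u : (l.*2).-tuple bool := Tuple (size_block_of u).

Lemma block_vertexK s a b : block_of (block_vertex s a b) = s.
Proof. by apply: val_inj => /=; rewrite take_size_cat ?size_tuple. Qed.

Lemma block_vertexP u : exists s a b, u = block_vertex s a b.
Proof.
exists (block_of u).
have : size (drop l.*2 u) = 2 by rewrite size_drop size_tuple -addn2 addKn.
case E: (drop l.*2 u) => [|a [|b []]] // _; exists a, b.
by apply: val_inj; rewrite /= -E cat_take_drop.
Qed.

Lemma block_vertex_inj s t a b c d :
  block_vertex s a b = block_vertex t c d -> [/\ s = t, a = c & b = d].
Proof.
move=> E; have st : s = t by rewrite -(block_vertexK s a b) E block_vertexK.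
by subst t; have /eqP := congr1 val E; rewrite /= eqseq_cat // => /andP[_ /eqP[]].
Qed.

Lemma adj_block_vertex s a b c d :
  adj (block_vertex s a b) (block_vertex s c d)
  = cycle4_adj [:: a; b] [:: c; d].
Proof. by rewrite /adj /= fcn_adj_block ?size_tuple. Qed.

(** No joining edge reaches this vertex, so its neighbours stay in its 4-cycle. The right side is
    independent of [a], whence the twins. *)
Lemma adj_diagonal s a u :
  adj (block_vertex s a a) u =
  [exists b, u == block_vertex s b (~~ b)].
Proof.
have [t [c [d ->]]] := block_vertexP u; apply/idP/existsP => [h|[b /eqP->]].
  have st : s = t by apply/val_inj/(fcn_adj_same_block _ _ h); rewrite size_tuple.
  by subst t; move: h; rewrite adj_block_vertex; exists c; case: a c d h => [] [] [].
by rewrite adj_block_vertex; case: a b => [] [].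
Qed.

(** Each twin neighbourhood lies in a single block, and the blocks, being the fibres of [block_of],
    are disjoint. *)
Lemma leq_card_blocks (D : {set FCN l}) :
    (forall s, 2 <= #|D :&: twin_neighbourhood (block_vertex s false false)
                                               (block_vertex s true true)|) ->
  2 ^ l.*2.+1 <= #|D|.
Proof.
move=> hD; rewrite -sum1_card (partition_big block_of predT) //=.
(* The bound becomes the constant 2 summed over all blocks. *)
rewrite expnSr -{1}card_bool -card_tuple -sum_nat_const.
apply: leq_sum => s _; rewrite sum1_card; apply: leq_trans (hD s) _.
apply/subset_leq_card/subsetP => u; rewrite !inE => /andP[uD hu].
rewrite unfold_in /= uD /=; case/or3P: hu => [/eqP->|/eqP->|]; rewrite ?block_vertexK //.
by rewrite adj_diagonal => /existsP[b /eqP->]; rewrite block_vertexK.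
Qed.

Definition diagonal : {set FCN l} :=
  [set block_vertex x.1 x.2 x.2 | x : (l.*2).-tuple bool * bool].

Lemma mem_diagonal s a b : (block_vertex s a b \in diagonal) = (a == b).
Proof.
apply/imsetP/eqP => [[[t c] _ /block_vertex_inj[_ -> ->]] //|->].
by exists (s, b).
Qed.

Lemma card_diagonal : #|diagonal| = 2 ^ l.*2.+1.
Proof.
rewrite card_imset ?card_prod ?card_tuple ?card_bool ?expnSr //.
by move=> [s a] [t b] /block_vertex_inj[/= -> ->].
Qed.

Lemma off_diagonalP u :
  u \notin diagonal -> exists s b, u = block_vertex s b (~~ b).
Proof.
have [s [a [b ->]]] := block_vertexP u; rewrite mem_diagonal => ab.
by exists s, a; case: a b ab => [] [].
Qed.

Lemma block_twins s :
  adj (block_vertex s false false) =1 adj (block_vertex s true true).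
Proof. by move=> u; rewrite !adj_diagonal. Qed.

Lemma block_twins_neq s : block_vertex s false false != block_vertex s true true.
Proof. by apply/eqP => /block_vertex_inj[]. Qed.

Lemma two_dominating_diagonal : two_dominating diagonal.
Proof.
apply/forallP=> u; apply/implyP=> /off_diagonalP[s [b ->]].
apply/card_gt1P; exists (block_vertex s false false), (block_vertex s true true).
by rewrite !inE !mem_diagonal !adj_block_vertex block_twins_neq; case: b.
Qed.

Lemma dominating_diagonal : dominating diagonal.
Proof.
apply/forallP=> u; case: (boolP (u \in diagonal)) => // /off_diagonalP[s [b ->]].
apply/exists_inP; exists (block_vertex s true true).
  by rewrite mem_diagonal.
by rewrite adj_block_vertex; case: b.
Qed.

End Blocks.

Arguments diagonal : clear implicits.

(** * Values of the two invariants *)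

Theorem two_domination_number_FCN l :
  two_domination_number (FCN l) = 2 ^ l.*2.+1.
Proof.
rewrite -card_diagonal; apply: card_arg_min.
- exact: two_dominatingT.
- exact: two_dominating_diagonal.
- move=> D hD; rewrite card_diagonal; apply: leq_card_blocks => s.
  exact: twin_two_dominating (block_twins_neq s) (block_twins s) _ hD.
Qed.

(* A vertex r = s'00 of a block joined to s by the edge {s10, s'10} is at
   distance 2 from s10 but more than 2 from s01. *)
Lemma resolves_within_block l (s : (l.+1.*2).-tuple bool) :
  exists2 r, r \in diagonal l.+1 &
    gdist (block_vertex s true false) r != gdist (block_vertex s false true) r.
Proof.
(* The prefix [s] is itself a vertex of [FCN l]; flipping the first bit of its last pair gives a
   neighbouring prefix on the cycle of joined copies. *)
have [s0 [a [b Es]]] := @block_vertexP l s.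
pose s' : (l.+1.*2).-tuple bool := @block_vertex l s0 (~~ a) b.
have ss' : s != s'.
  by apply/eqP; rewrite Es => /block_vertex_inj[_ /eqP]; case: (a).
(* Removing the common prefix [s0] leaves adjacency in [FCN 1], with joining word 10, decidable by
   cases. *)
have cross c d c' d' : adj (block_vertex s c d) (block_vertex s' c' d') =
    fcn_adj 1 [:: a; b; c; d] [:: ~~ a; b; c'; d'].
  rewrite -[LHS]/(fcn_adj l.+1 (s ++ [:: c; d]) (s' ++ [:: c'; d'])) Es.
  by rewrite -!catA -[in LHS]addn1 fcn_adj_cat ?size_tuple.
exists (block_vertex s' false false); first by rewrite mem_diagonal.
have conn := @FCN_connected l.+1; apply/eqP => E.
have : gdist (block_vertex s true false) (block_vertex s' false false) <= 2.
  apply/gdist_le2P => //; right; exists (block_vertex s' true false).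
    by rewrite cross; case: (a) (b) => [] [].
  by rewrite adj_block_vertex.
(* A walk of length at most 2 from s01 is refuted: the end lies in another block, is not adjacent,
   and its neighbours s'01 and s'10 are not adjacent to s01. *)
rewrite {}E => /(gdist_le2P _ _ conn)[/(gdist_le1P _ _ conn)[]|[z +]].
- by move/block_vertex_inj => [/eqP]; rewrite (negPf ss').
- by rewrite cross; case: (a) (b) => [] [].
- rewrite [in X in _ -> X]adj_sym adj_diagonal => + /existsP[c /eqP E].
  by rewrite {}E cross; case: (a) (b) c => [] [] [].
Qed.

(** A vertex of the set separates itself from any other. Two vertices outside it are either s01 and
    s10 of one block, treated above, or lie in different blocks. *)
Lemma resolving_diagonal l : resolving (diagonal l.+1).
Proof.
apply/forallP=> g; apply/forallP=> h; apply/implyP=> ngh; apply/exists_inP.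
have self u v : u != v -> gdist u u != gdist v u.
  move=> nuv; have /eqP-> : gdist u u == 0 by rewrite gdist_eq0.
  by rewrite eq_sym gdist_eq0 eq_sym.
case: (boolP (g \in diagonal _)) => [gD|]; first by exists g => //; apply: self.
case: (boolP (h \in diagonal _)) => [hD _|].
  by exists h => //; rewrite eq_sym self // eq_sym.
move=> /off_diagonalP[t [c Eh]] /off_diagonalP[s [b Eg]].
case: (eqVneq s t) => [st|nst].
  have [r rD dr] := resolves_within_block s; exists r => //.
  move: ngh dr; rewrite Eg Eh st.
  by case: b c {Eg Eh} => [] []; rewrite ?eqxx // => _; rewrite eq_sym.
(* This vertex is adjacent to [g], while all vertices within distance 1 of it are in block [s],
   which excludes [h]. *)
pose r := block_vertex s false false.
exists r; first by rewrite mem_diagonal.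
have gr : adj g r by rewrite Eg adj_sym adj_diagonal; apply/existsP; exists b.
have conn := @FCN_connected l.+1; apply/eqP => E.
have : gdist g r <= 1 by apply/gdist_le1P => //; right.
rewrite E Eh => /(gdist_le1P _ _ conn)[/block_vertex_inj[/esym/eqP]|].
  by rewrite (negPf nst).
rewrite adj_sym adj_diagonal => /existsP[d /eqP/block_vertex_inj[/esym/eqP]].
by rewrite (negPf nst).
Qed.

Theorem resolving_domination_number_FCN l :
  resolving_domination_number (FCN l.+1) = 2 ^ l.+1.*2.+1.
Proof.
rewrite -card_diagonal; apply: card_arg_min.
- exact: resolving_dominatingT.
- by rewrite /resolving_dominating resolving_diagonal dominating_diagonal.
- move=> D hD; rewrite card_diagonal; apply: leq_card_blocks => s.
  exact: twin_resolving_dominating (block_twins_neq s) (block_twins s) _ hD.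
Qed.

Theorem theorem27 (l : nat) (hl : 1 <= l) :
  resolving_domination_number (FCN l) = 4 * two_domination_number (FCN (l - 1)).
Proof.
case: l hl => // l _; rewrite subn1 /=.
(* The factor 4 is read as [2 ^ 2] and absorbed into the exponent. *)
by rewrite resolving_domination_number_FCN two_domination_number_FCN -(expnD 2 2).
Qed.
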